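(* Let $(P,\cdot_P,\{-,-\}_P)$ be a coherent noncommutative Poisson algebra with two linear maps (comultiplications) $\Delta:P\to P\otimes P$ and $\delta:P\to\wedge^2P$. Suppose that the dual maps $\Delta^*$ and $\delta^*$ induce a coherent noncommutative Poisson algebra structure on $P^*$, with operations $\alpha\cdot_{P^*}\beta=\Delta^*(\alpha,\beta)$ and $\{\alpha,\beta\}_{P^*}=\delta^*(\alpha,\beta)$. Then the following statements are equivalent: (i) $((P,\cdot_P,\{-,-\}_P),\Delta,\delta)$ is a noncommutative Poisson bialgebra. (ii) $(P,P^* )$ together with the representations $(-R^*,-L^*,\mathrm{ad}^* ):P\to\mathfrak{gl}(P^* )$ and $(-\mathfrak R^*,-\mathfrak L^*,\mathfrak{ad}^* ):P^*\to\mathfrak{gl}(P)$ is a matched pair of (coherent) noncommutative Poisson algebras, where $\mathfrak R^*,\mathfrak L^*,\mathfrak{ad}^*$ are given by $\langle\mathfrak R^*_\alpha x,\beta\rangle=-\langle x,\beta\cdot_{P^*}\alpha\rangle$, $\langle\mathfrak L^*_\alpha x,\beta\rangle=-\langle x,\alpha\cdot_{P^*}\beta\rangle$, $\langle\mathfrak{ad}^*_\alpha x,\beta\rangle=-\langle x,\{\alpha,\beta\}_{P^*}\rangle$ for all $x\in P$, $\alpha,\beta\in P^*$. (iii) $((P\oplus P^*,\mathfrak B),P,P^* )$ is a Manin triple of noncommutative Poisson algebras, where the invariant symmetric bilinear form $\mathfrak B$ on $P\oplus P^*$ is given by $\mathfrak B(x+\alpha,y+\beta)=\langle x,\beta\rangle+\langle\alpha,y\rangle$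 for all $x,y\in P$, $\alpha,\beta\in P^*$; that is, there is a noncommutative Poisson algebra structure on $P\oplus P^*$ containing $P$ and $P^*$ (with their given structures) as subalgebras and with respect to which $\mathfrak B$ is invariant.
   Context: All vector spaces are finite dimensional over an algebraically closed field $\mathbb K$ of characteristic $0$. A noncommutative Poisson algebra $(P,\cdot_P,\{-,-\}_P)$ is a vector space with an associative (not necessarily commutative) product $\cdot_P$ and a Lie bracket $\{-,-\}_P$ such that $\{x,y\cdot_Pz\}_P=\{x,y\}_P\cdot_Pz+y\cdot_P\{x,z\}_P$. It is coherent if $\{x,y\cdot_Pz\}_P+\{y,z\cdot_Px\}_P+\{z,x\cdot_Py\}_P=0$ for all $x,y,z\in P$. Write $L_xy=x\cdot_Py$, $R_xy=y\cdot_Px$, $\mathrm{ad}_xy=\{x,y\}_P$. For a linear map $\mu:P\to\mathfrak{gl}(V)$, $\mu^*:P\to\mathfrak{gl}(V^* )$ is defined by $\langle\mu^*_x\alpha,v\rangle=-\langle\alpha,\mu_xv\rangle$. Let $\tau(x\otimes y)=y\otimes x$. A representation of $P$ is $(V;\mathcal L,\mathcal R,\rho)$ with linear maps $\mathcal L,\mathcal R,\rho:P\to\mathfrak{gl}(V)$ such that $\mathcal L_{x\cdot_Py}=\mathcal L_x\mathcal L_y$, $\mathcal R_{x\cdot_Py}=\mathcal R_y\mathcal R_x$, $\mathcal L_x\mathcal R_y=\mathcal R_y\mathcal L_x$, $\rho(\{x,y\}_P)=[\rho(x),\rho(y)]$, $\mathcal L_{\{x,y\}_P}=\rho(x)\mathcal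 L_y-\mathcal L_y\rho(x)$, $\mathcal R_{\{x,y\}_P}=\rho(x)\mathcal R_y-\mathcal R_y\rho(x)$ and $\rho(x\cdot_Py)=\mathcal L_x\rho(y)+\mathcal R_y\rho(x)$ for all $x,y$. Dual maps: $\langle\Delta^*(\alpha,\beta),x\rangle=\langle\Delta(x),\alpha\otimes\beta\rangle$ and $\langle\delta^*(\alpha,\beta),x\rangle=\langle\delta(x),\alpha\otimes\beta\rangle$, regarding $\wedge^2P\subset P\otimes P$ as the skew-symmetric tensors. Noncommutative Poisson bialgebra: a triple $((P,\cdot_P,\{-,-\}_P),\Delta,\delta)$ with $P$ coherent, $\Delta:P\to P\otimes P$, $\delta:P\to\wedge^2P$ linear, such that (a) $(P^*,\Delta^*,\delta^* )$ is a noncommutative Poisson algebra which is moreover coherent; (b) for all $x,y\in P$ $$\Delta(x\cdot_Py)=(1\otimes L_x)\Delta(y)+(R_y\otimes1)\Delta(x),$$ $$\Delta(\{x,y\}_P)=(\mathrm{ad}_x\otimes1+1\otimes\mathrm{ad}_x)\Delta(y)-(1\otimes L_y)\delta(x)+(R_y\otimes1)\delta(x),$$ $$\delta(\{x,y\}_P)=(\mathrm{ad}_x\otimes1+1\otimes\mathrm{ad}_x)\delta(y)-(\mathrm{ad}_y\otimes1+1\otimes\mathrm{ad}_y)\delta(x);$$ (c) for all $x,y\in P$ $$(L_y\otimes1-1\otimes R_y)\Delta(x)+\tau\big((L_x\otimes1-1\otimes R_x)\Delta(y)\big)=0,$$ $$(L_x\otimes1)\delta(y)+(R_y\otimes1)\delta(x)+(1\otimes\mathrm{ad}_x)\Delta(y)+(1\otimes\mathrm{ad}_y)\tau(\Delta(x))=\delta(x\cdot_Py).$$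 Matched pair of noncommutative Poisson algebras: noncommutative Poisson algebras $(P_1,\cdot_1,\{,\}_{P_1})$, $(P_2,\cdot_2,\{,\}_{P_2})$ with representations $(\mathcal L,\mathcal R,\rho)$ of $P_1$ on $P_2$ and $(\tilde{\mathcal L},\tilde{\mathcal R},\varrho)$ of $P_2$ on $P_1$ such that for all $x,y\in P_1$, $\alpha,\beta\in P_2$ the following hold. Lie conditions: $\varrho(\alpha)\{x,y\}_{P_1}=\{\varrho(\alpha)x,y\}_{P_1}+\{x,\varrho(\alpha)y\}_{P_1}-\varrho(\rho(x)\alpha)y+\varrho(\rho(y)\alpha)x$; $\rho(x)\{\alpha,\beta\}_{P_2}=\{\rho(x)\alpha,\beta\}_{P_2}+\{\alpha,\rho(x)\beta\}_{P_2}-\rho(\varrho(\alpha)x)\beta+\rho(\varrho(\beta)x)\alpha$. Associative conditions: $\mathcal L_x(\alpha\cdot_2\beta)=\mathcal L_{\tilde{\mathcal R}_\alpha x}\beta+(\mathcal L_x\alpha)\cdot_2\beta$; $\mathcal R_x(\alpha\cdot_2\beta)=\mathcal R_{\tilde{\mathcal L}_\beta x}\alpha+\alpha\cdot_2\mathcal R_x\beta$; $\tilde{\mathcal L}_\alpha(x\cdot_1y)=\tilde{\mathcal L}_{\mathcal R_x\alpha}y+(\tilde{\mathcal L}_\alpha x)\cdot_1y$; $\tilde{\mathcal R}_\alpha(x\cdot_1y)=\tilde{\mathcal R}_{\mathcal L_y\alpha}x+x\cdot_1\tilde{\mathcal R}_\alpha y$; $\mathcal L_{\tilde{\mathcal L}_\alpha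 x}\beta+(\mathcal R_x\alpha)\cdot_2\beta-\mathcal R_{\tilde{\mathcal R}_\beta x}\alpha-\alpha\cdot_2\mathcal L_x\beta=0$; $\tilde{\mathcal L}_{\mathcal L_x\alpha}y+(\tilde{\mathcal R}_\alpha x)\cdot_1y-\tilde{\mathcal R}_{\mathcal R_y\alpha}x-x\cdot_1\tilde{\mathcal L}_\alpha y=0$. Mixed conditions: $\rho(x)(\alpha\cdot_2\beta)=(\rho(x)\alpha)\cdot_2\beta+\alpha\cdot_2\rho(x)\beta-\mathcal L_{\varrho(\alpha)x}\beta-\mathcal R_{\varrho(\beta)x}\alpha$; $\mathcal L_x\{\alpha,\beta\}_{P_2}=\{\alpha,\mathcal L_x\beta\}_{P_2}-\rho(\tilde{\mathcal R}_\beta x)\alpha-\mathcal L_{\varrho(\alpha)x}\beta+(\rho(x)\alpha)\cdot_2\beta$; $\varrho(\alpha)(x\cdot_1y)=(\varrho(\alpha)x)\cdot_1y+x\cdot_1\varrho(\alpha)y-\tilde{\mathcal L}_{\rho(x)\alpha}y-\tilde{\mathcal R}_{\rho(y)\alpha}x$; $\tilde{\mathcal L}_\alpha\{x,y\}_{P_1}=\{x,\tilde{\mathcal L}_\alpha y\}_{P_1}-\varrho(\mathcal R_y\alpha)x-\tilde{\mathcal L}_{\rho(x)\alpha}y+(\varrho(\alpha)x)\cdot_1y$. Manin triple of noncommutative Poisson algebras: $((Q,\mathfrak B),P_1,P_2)$, where $Q$ is a noncommutative Poisson algebra with a nondegenerate symmetric bilinear form $\mathfrak B$ that is invariant, i.e.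 $\mathfrak B(\{a,b\}_Q,c)=\mathfrak B(a,\{b,c\}_Q)$ and $\mathfrak B(a\cdot_Qb,c)=\mathfrak B(a,b\cdot_Qc)$, and $P_1,P_2$ are noncommutative Poisson subalgebras of $Q$, isotropic for $\mathfrak B$, with $Q=P_1\oplus P_2$ as vector spaces. *)

(* Defs.v *)
From HB Require Import structures.
From mathcomp Require Import all_boot all_order all_algebra.

Set Implicit Arguments.
Unset Strict Implicit.
Unset Printing Implicit Defensive.

Import GRing.Theory.
Local Open Scope ring_scope.

Notation dual V := 'Hom(V, GRing.regular _).
Local Notation bilinear f := (bilinear_for *:%R *:%R f).

Section LinearAlgebra.
Variable K : fieldType.
Implicit Types P Q U V W : vectType K.

Lemma linfunE U V (f : U -> V) : linear f -> linfun f =1 f.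
Proof.
move=> lf x.
pose F : {linear U -> V} :=
  HB.pack f (GRing.isLinear.Build K U V *:%R f lf).
exact: (lfunE F).
Qed.

(* Bilinear maps U -> V -> W are represented as elements of
   'Hom(U, 'Hom(V, W)); in particular a linear map P -> gl(V) and a bilinear
   product on P both live in 'Hom(P, 'End(_)). *)
Definition blin U V W (f : U -> V -> W) : 'Hom(U, 'Hom(V, W)) :=
  linfun (fun x => linfun (f x)).

Lemma blinE U V W (f : U -> V -> W) :
  bilinear f -> forall x y, blin f x y = f x y.
Proof.
move=> [fl fr] x y; rewrite linfunE ?linfunE//.
by move=> a u v; apply/lfunP => z; rewrite !lfun_simp !linfunE// fl.
Qed.

Definition flip U V W (f : 'Hom(U, 'Hom(V, W))) : 'Hom(V, 'Hom(U, W)) :=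
  blin (fun y x => f x y).

Lemma flipE U V W (f : 'Hom(U, 'Hom(V, W))) y x : flip f y x = f x y.
Proof.
rewrite blinE//; split=> [u a v w|u a v w]; first by rewrite linearP.
by rewrite linearP !lfun_simp.
Qed.

Definition vbase V (i : 'I_(\dim {:V})) : V := (vbasis {:V})`_i.

Definition vcoord V (i : 'I_(\dim {:V})) : dual V :=
  linfun (coord (vbasis {:V}) i : V -> K^o).

Lemma vcoordP V (x : V) : x = \sum_i vcoord i x *: vbase i.
Proof.
rewrite {1}(coord_vbasis (memvf x)).
by apply: eq_bigr => i _; rewrite lfunE.
Qed.

Lemma vcoord_vbase V (i j : 'I_(\dim {:V})) : vcoord i (vbase j) = (i == j)%:R.
Proof.
have fX := basis_free (vbasisP {:V}).
by rewrite /vcoord lfunE eq_sym; exact: coord_free fX.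
Qed.

(* The tensor product, in coordinates: x (x) y is the matrix of the products of
   the coordinates of x and y.  Only the universal property (tens_bilinear,
   tliftE, tlift_uniq) matters, and every map on tensors below is given by
   tlift through its values on pure tensors. *)
Definition tensor U V : vectType K := 'M[K]_(\dim {:U}, \dim {:V}).

Definition tens U V (x : U) (y : V) : tensor U V :=
  \matrix_(i, j) (vcoord i x * vcoord j y).

Definition tlift U V W (b : U -> V -> W) : 'Hom(tensor U V, W) :=
  linfun (fun t : 'M[K]_(\dim {:U}, \dim {:V}) =>
    \sum_i \sum_j t i j *: b (vbase i) (vbase j)).

Lemma tens_bilinear U V : bilinear (@tens U V).
Proof.
split=> [y a u v|x a u v].
  by apply/matrixP => i j; rewrite !mxE linearP mulrDl -scalerAl.
by apply/matrixP => i j; rewrite !mxE linearP mulrDr -scalerAr.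
Qed.

Lemma tliftE U V W (b : U -> V -> W) :
  bilinear b -> forall x y, tlift b (tens x y) = b x y.
Proof.
move=> [bl br] x y; rewrite linfunE; last first.
  move=> a s t; rewrite scaler_sumr -big_split; apply: eq_bigr => i _ /=.
  rewrite scaler_sumr -big_split; apply: eq_bigr => j _ /=.
  by rewrite !mxE scalerDl scalerA.
have fl (z : V) (F : 'I_(\dim {:U}) -> K) :
    b (\sum_i F i *: vbase i) z = \sum_i F i *: b (vbase i) z.
  pose L : 'Hom(U, W) := linfun (b^~ z).
  have LE u : b u z = L u by rewrite linfunE.
  by rewrite LE linear_sum; apply: eq_bigr => i _; rewrite linearZ LE.
have fr (z : U) (F : 'I_(\dim {:V}) -> K) :
    b z (\sum_i F i *: vbase i) = \sum_i F i *: b z (vbase i).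
  pose L : 'Hom(V, W) := linfun (b z).
  have LE u : b z u = L u by rewrite linfunE.
  by rewrite LE linear_sum; apply: eq_bigr => i _; rewrite linearZ LE.
rewrite [in RHS](vcoordP x) fl; apply: eq_bigr => i _.
rewrite [in RHS](vcoordP y) fr scaler_sumr; apply: eq_bigr => j _.
by rewrite scalerA mxE.
Qed.

Lemma tlift_uniq U V W (f g : 'Hom(tensor U V, W)) :
  (forall x y, f (tens x y) = g (tens x y)) -> f = g.
Proof.
move=> fg; apply/lfunP => t.
have -> : t = \sum_i \sum_j (t : 'M_(_, _)) i j *: tens (vbase i) (vbase j).
  rewrite [LHS]matrix_sum_delta; apply: eq_bigr => i _; apply: eq_bigr => j _.
  congr (_ *: _); apply/matrixP => k l.
  by rewrite !mxE !vcoord_vbase -natrM mulnb.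
rewrite !linear_sum; apply: eq_bigr => i _.
by rewrite !linear_sum; apply: eq_bigr => j _; rewrite !linearZ /= fg.
Qed.

Definition tmap U V U' V' (f : 'Hom(U, U')) (g : 'Hom(V, V')) :
    'Hom(tensor U V, tensor U' V') :=
  tlift (fun x y => tens (f x) (g y)).

Lemma tmapE U V U' V' (f : 'Hom(U, U')) (g : 'Hom(V, V')) x y :
  tmap f g (tens x y) = tens (f x) (g y).
Proof.
have [tl tr] := tens_bilinear U' V'.
by rewrite tliftE//; split=> [z a u v|z a u v]; rewrite linearP ?tl ?tr.
Qed.

Definition tau U V : 'Hom(tensor U V, tensor V U) :=
  tlift (fun x y => tens y x).

Lemma tauE U V (x : U) (y : V) : tau U V (tens x y) = tens y x.
Proof.
have [tl tr] := tens_bilinear V U.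
by rewrite tliftE//; split=> [z a u v|z a u v]; rewrite ?tl ?tr.
Qed.

Definition wedge2 V : {vspace tensor V V} := lker (tau V V + \1)%VF.

Lemma wedge2P V (t : tensor V V) : reflect (tau V V t = - t) (t \in wedge2 V).
Proof. by rewrite memv_ker !lfun_simp addr_eq0; apply: eqP. Qed.

(* The pairing of a (x) b with tensors. *)
Definition tpair U V (a : dual U) (b : dual V) : dual (tensor U V) :=
  tlift (fun x y => a x * b y : K^o).

Lemma tpairE U V (a : dual U) (b : dual V) x y :
  tpair a b (tens x y) = a x * b y.
Proof.
rewrite tliftE//; split=> [z c u v|z c u v]; rewrite linearP.
  by rewrite mulrDl -scalerAl.
by rewrite mulrDr -scalerAr.
Qed.

Lemma tpair_bilinear U V : bilinear (@tpair U V).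
Proof.
split=> [b c u v|a c u v]; apply: tlift_uniq => x y.
  by rewrite !lfun_simp !tpairE !lfun_simp mulrDl -scalerAl.
by rewrite !lfun_simp !tpairE !lfun_simp mulrDr -scalerAr.
Qed.

(* Delta^*, as a product on the dual of P. *)
Definition dualprod P (D : 'Hom(P, tensor P P)) : 'Hom(dual P, 'End(dual P)) :=
  blin (fun a b : dual P => (tpair a b \o D)%VF).

Lemma dualprodE P (D : 'Hom(P, tensor P P)) a b x :
  dualprod D a b x = tpair a b (D x).
Proof.
have [tl tr] := tpair_bilinear P P.
rewrite blinE ?comp_lfunE//; split=> [z c u v|z c u v].
  by apply/lfunP => w; rewrite tl !lfun_simp.
by apply/lfunP => w; rewrite tr !lfun_simp.
Qed.

(* mu^* for mu : P -> gl(V). *)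
Definition dualrep P V (mu : 'Hom(P, 'End(V))) : 'Hom(P, 'End(dual V)) :=
  blin (fun x (a : dual V) => - (a \o mu x)%VF).

Lemma dualrepE P V (mu : 'Hom(P, 'End(V))) x a v :
  dualrep mu x a v = - a (mu x v).
Proof.
rewrite blinE ?lfun_simp//; split=> [z c u w|z c u w].
  by apply/lfunP => t; rewrite linearP !lfun_simp linearP opprD scalerN.
by apply/lfunP => t; rewrite !lfun_simp opprD scalerN.
Qed.

(* The inverse of the canonical isomorphism from V to its double dual. *)
Definition undual V (F : dual (dual V)) : V := \sum_i F (vcoord i) *: vbase i.

Lemma undualE V (F : dual (dual V)) (b : dual V) : b (undual F) = F b.
Proof.
have -> : b = \sum_i b (vbase i) *: vcoord i.
  apply/lfunP => x; rewrite [in LHS](vcoordP x) linear_sum sum_lfunE.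
  apply: eq_bigr => i _; rewrite linearZ scale_lfunE.
  exact: mulrC.
rewrite [RHS]linear_sum sum_lfunE; apply: eq_bigr => i _.
rewrite scale_lfunE linearZ /undual; congr (_ *: _).
have E j : vcoord i (F (vcoord j) *: vbase j) = F (vcoord j) * (i == j)%:R.
  by rewrite linearZ -vcoord_vbase.
rewrite linear_sum (eq_bigr _ (fun j _ => E j)).
rewrite (bigD1 i)//= eqxx mulr1 big1 ?addr0// => j /negPf ji.
by rewrite eq_sym ji mulr0.
Qed.

Lemma dual_inj V (x y : V) : (forall b : dual V, b x = b y) -> x = y.
Proof.
move=> xy; rewrite (vcoordP x) (vcoordP y); apply: eq_bigr => i _.
by rewrite xy.
Qed.

(* nu^* for nu : Q -> gl(P^* ), taking values in gl(P) through the
   identification of P with its double dual. *)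
Definition corep Q P (nu : 'Hom(Q, 'End(dual P))) : 'Hom(Q, 'End(P)) :=
  blin (fun a (x : P) => undual (linfun (fun b : dual P => - nu a b x : K^o))).

Lemma corepE Q P (nu : 'Hom(Q, 'End(dual P))) a x (b : dual P) :
  b (corep nu a x) = - nu a b x.
Proof.
have E c z (d : dual P) :
    d (undual (linfun (fun b : dual P => - nu c b z : K^o))) = - nu c d z.
  rewrite undualE linfunE// => k u v.
  by rewrite linearP !lfun_simp opprD scalerN.
rewrite blinE ?E//; split=> [z c u v|z c u v]; apply: dual_inj => d.
  by rewrite E [RHS]linearP /= !E linearP !lfun_simp opprD scalerN.
by rewrite E [RHS]linearP /= !E linearP opprD scalerN.
Qed.

End LinearAlgebra.

Section NcPoisson.
Variable K : fieldType.
Implicit Types P Q V : vectType K.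

Record ncPoisson P (mul br : 'Hom(P, 'End(P))) : Prop := NcPoisson {
  ncp_mulA : forall x y z, mul (mul x y) z = mul x (mul y z);
  ncp_alt : forall x, br x x = 0;
  ncp_jacobi : forall x y z,
    br x (br y z) + br y (br z x) + br z (br x y) = 0;
  ncp_leibniz : forall x y z,
    br x (mul y z) = mul (br x y) z + mul y (br x z) }.

Definition coherent P (mul br : 'Hom(P, 'End(P))) : Prop :=
  forall x y z, br x (mul y z) + br y (mul z x) + br z (mul x y) = 0.

(* The parentheses matter: \o, + and - are at the same precedence level. *)
Record ncp_rep P (mul br : 'Hom(P, 'End(P))) V (L R rho : 'Hom(P, 'End(V))) :
    Prop := NcpRep {
  ncpr_L : forall x y, L (mul x y) = (L x \o L y)%VF;
  ncpr_R : forall x y, R (mul x y) = (R y \o R x)%VF;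
  ncpr_LR : forall x y, (L x \o R y)%VF = (R y \o L x)%VF;
  ncpr_rho : forall x y, rho (br x y) = ((rho x \o rho y) - (rho y \o rho x))%VF;
  ncpr_Lbr : forall x y, L (br x y) = ((rho x \o L y) - (L y \o rho x))%VF;
  ncpr_Rbr : forall x y, R (br x y) = ((rho x \o R y) - (R y \o rho x))%VF;
  ncpr_rhomul : forall x y,
    rho (mul x y) = ((L x \o rho y) + (R y \o rho x))%VF }.

(* The operators L_x and ad_x are [mul x] and [br x]; R_x is [flip mul x]. *)
Record ncp_bialgebra P (mul br : 'Hom(P, 'End(P)))
    (Delta delta : 'Hom(P, tensor P P)) : Prop := NcpBialgebra {
  ncpb_alg : ncPoisson mul br;
  ncpb_coh : coherent mul br;
  ncpb_wedge : forall x, delta x \in wedge2 P;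
  ncpb_dual : ncPoisson (dualprod Delta) (dualprod delta);
  ncpb_dual_coh : coherent (dualprod Delta) (dualprod delta);
  ncpb_Delta_mul : forall x y,
    Delta (mul x y) =
      tmap \1 (mul x) (Delta y) + tmap (flip mul y) \1 (Delta x);
  ncpb_Delta_br : forall x y,
    Delta (br x y) =
      (tmap (br x) \1 + tmap \1 (br x))%VF (Delta y)
      - tmap \1 (mul y) (delta x) + tmap (flip mul y) \1 (delta x);
  ncpb_delta_br : forall x y,
    delta (br x y) =
      (tmap (br x) \1 + tmap \1 (br x))%VF (delta y)
      - (tmap (br y) \1 + tmap \1 (br y))%VF (delta x);
  ncpb_Delta_sym : forall x y,
    (tmap (mul y) \1 - tmap \1 (flip mul y))%VF (Delta x)
    + tau P P ((tmap (mul x) \1 - tmap \1 (flip mul x))%VF (Delta y)) = 0;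
  ncpb_delta_mul : forall x y,
    tmap (mul x) \1 (delta y) + tmap (flip mul y) \1 (delta x)
    + tmap \1 (br x) (Delta y) + tmap \1 (br y) (tau P P (Delta x))
    = delta (mul x y) }.

Record matched_pair P1 P2
    (mul1 br1 : 'Hom(P1, 'End(P1))) (mul2 br2 : 'Hom(P2, 'End(P2)))
    (L R rho : 'Hom(P1, 'End(P2))) (L' R' rho' : 'Hom(P2, 'End(P1))) :
    Prop := MatchedPair {
  mp_alg1 : ncPoisson mul1 br1;
  mp_alg2 : ncPoisson mul2 br2;
  mp_rep1 : ncp_rep mul1 br1 L R rho;
  mp_rep2 : ncp_rep mul2 br2 L' R' rho';
  mp_lie1 : forall x y a,
    rho' a (br1 x y) = br1 (rho' a x) y + br1 x (rho' a y)
      - rho' (rho x a) y + rho' (rho y a) x;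
  mp_lie2 : forall x a b,
    rho x (br2 a b) = br2 (rho x a) b + br2 a (rho x b)
      - rho (rho' a x) b + rho (rho' b x) a;
  mp_ass1 : forall x a b,
    L x (mul2 a b) = L (R' a x) b + mul2 (L x a) b;
  mp_ass2 : forall x a b,
    R x (mul2 a b) = R (L' b x) a + mul2 a (R x b);
  mp_ass3 : forall x y a,
    L' a (mul1 x y) = L' (R x a) y + mul1 (L' a x) y;
  mp_ass4 : forall x y a,
    R' a (mul1 x y) = R' (L y a) x + mul1 x (R' a y);
  mp_ass5 : forall x a b,
    L (L' a x) b + mul2 (R x a) b - R (R' b x) a - mul2 a (L x b) = 0;
  mp_ass6 : forall x y a,
    L' (L x a) y + mul1 (R' a x) y - R' (R y a) x - mul1 x (L' a y) = 0;
  mp_mix1 : forall x a b,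
    rho x (mul2 a b) = mul2 (rho x a) b + mul2 a (rho x b)
      - L (rho' a x) b - R (rho' b x) a;
  mp_mix2 : forall x a b,
    L x (br2 a b) = br2 a (L x b) - rho (R' b x) a
      - L (rho' a x) b + mul2 (rho x a) b;
  mp_mix3 : forall x y a,
    rho' a (mul1 x y) = mul1 (rho' a x) y + mul1 x (rho' a y)
      - L' (rho x a) y - R' (rho y a) x;
  mp_mix4 : forall x y a,
    L' a (br1 x y) = br1 x (L' a y) - rho' (R y a) x
      - L' (rho x a) y + mul1 (rho' a x) y }.

Definition subalgebra Q (mul br : 'Hom(Q, 'End(Q))) (U : {vspace Q}) : Prop :=
  {in U &, forall a b, mul a b \in U /\ br a b \in U}.

Definition isotropic Q (B : 'Hom(Q, dual Q)) (U : {vspace Q}) : Prop :=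
  {in U &, forall a b, B a b = 0}.

Record manin_triple Q (mul br : 'Hom(Q, 'End(Q))) (B : 'Hom(Q, dual Q))
    (P1 P2 : {vspace Q}) : Prop := ManinTriple {
  mt_alg : ncPoisson mul br;
  mt_sym : forall a b, B a b = B b a;
  mt_nondeg : forall a, (forall b, B a b = 0) -> a = 0;
  mt_inv_br : forall a b c, B (br a b) c = B a (br b c);
  mt_inv_mul : forall a b c, B (mul a b) c = B a (mul b c);
  mt_sub1 : subalgebra mul br P1;
  mt_sub2 : subalgebra mul br P2;
  mt_iso1 : isotropic B P1;
  mt_iso2 : isotropic B P2;
  mt_sum : (P1 + P2)%VS = fullv;
  mt_direct : directv (P1 + P2) }.

Definition inP P : 'Hom(P, (P * dual P)%type) :=
  linfun (fun x : P => (x, 0 : dual P)).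

Definition inPdual P : 'Hom(dual P, (P * dual P)%type) :=
  linfun (fun a : dual P => (0 : P, a)).

Lemma inPE P x : inP P x = (x, 0).
Proof.
by rewrite linfunE// => a u v; apply/eqP/andP; rewrite /= scaler0 addr0.
Qed.

Lemma inPdualE P a : inPdual P a = (0, a).
Proof.
by rewrite linfunE// => c u v; apply/eqP/andP; rewrite /= scaler0 addr0.
Qed.

Definition natural_form P :
    'Hom((P * dual P)%type, dual (P * dual P)%type) :=
  blin (fun a b : P * dual P => b.2 a.1 + a.2 b.1 : K^o).

Lemma natural_formE P (a b : P * dual P) :
  natural_form P a b = b.2 a.1 + a.2 b.1.
Proof.
rewrite blinE//; split=> [z c u v|z c u v] /=.
  by rewrite linearP !lfun_simp scalerDr addrACA.
by rewrite linearP !lfun_simp scalerDr addrACA.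
Qed.

(* A Manin triple on P (+) P^* in which P and P^* carry the given structures. *)
Definition standard_manin_triple P (mul br : 'Hom(P, 'End(P)))
    (mul' br' : 'Hom(dual P, 'End(dual P))) : Prop :=
  exists mulQ brQ : 'Hom((P * dual P)%type, 'End((P * dual P)%type)),
    [/\ manin_triple mulQ brQ (natural_form P)
          (limg (inP P)) (limg (inPdual P)),
        forall x y, mulQ (inP P x) (inP P y) = inP P (mul x y),
        forall x y, brQ (inP P x) (inP P y) = inP P (br x y),
        forall a b, mulQ (inPdual P a) (inPdual P b) = inPdual P (mul' a b)
      & forall a b, brQ (inPdual P a) (inPdual P b) = inPdual P (br' a b)].

End NcPoisson.

(* Main.v *)
(* All three conditions say that the double P (+) P^*, with the mixed products
   that invariance of the natural form B forces, is a noncommutative Poisson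
   algebra.  By invariance the defects of associativity, Jacobi and Leibniz
   become the 4-linear forms
     B(uv, wz) - B(vw, zu),
     B({v,w}, {u,z}) + B({w,u}, {v,z}) + B({u,v}, {w,z}),
     B(vw, {u,z}) + B(wz, {u,v}) + B(zv, {u,w}),
   which are anticyclic in u, v, w, z (the first two) or cyclic in v, w, z (the
   last one).  So it suffices to evaluate them on one argument pattern per
   cyclic class.  Patterns with at most one argument in P, or at most one in
   P^*, give the axioms and the coherence of P and P^*; the remaining five are
   the bialgebra conditions paired with a (x) b.  The same symmetry explains why
   a matched pair need not mention R_x{a, b} and its dual. *)
Require Import Defs.
From mathcomp Require Import all_boot all_order all_algebra.
From mathcomp Require Import ring.
Import GRing.Theory.
Local Open Scope ring_scope.

Set Implicit Arguments.
Unset Strict Implicit.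
Unset Printing Implicit Defensive.

(** * Rewriting rules for linear and bilinear maps *)

Section Linear.
Variables (K : fieldType) (U V : vectType K).
Implicit Types f : 'Hom(U, V).

Lemma lfun0r f : f 0 = 0. Proof. exact: linear0. Qed.
Lemma lfunNr f u : f (- u) = - f u. Proof. exact: linearN. Qed.
Lemma lfunDr f u v : f (u + v) = f u + f v. Proof. exact: linearD. Qed.
Lemma lfunPr f c u v : f (c *: u + v) = c *: f u + f v.
Proof. exact: linearP. Qed.
End Linear.

Section Bilinear.
Variables (K : fieldType) (U V W : vectType K).
Implicit Types (m : 'Hom(U, 'Hom(V, W))).

Lemma lfun0l m x : m 0 x = 0. Proof. by rewrite lfun0r zero_lfunE. Qed.
Lemma lfunNl m u x : m (- u) x = - m u x.
Proof. by rewrite lfunNr opp_lfunE. Qed.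
Lemma lfunDl m u v x : m (u + v) x = m u x + m v x.
Proof. by rewrite lfunDr add_lfunE. Qed.
Lemma lfunPl m c u v x : m (c *: u + v) x = c *: m u x + m v x.
Proof. by rewrite lfunPr !lfun_simp. Qed.
End Bilinear.

Lemma alt_antisym (K : fieldType) (V : vectType K) (k : 'Hom(V, 'End(V))) :
  (forall x, k x x = 0) -> forall x y, k x y = - k y x.
Proof.
move=> alt x y; apply/eqP; rewrite -addr_eq0; apply/eqP.
by have := alt (x + y); rewrite lfunDl !lfunDr !alt add0r addr0.
Qed.

(** Lets [ring] derive one identity from another: it remains to see that both have the same
    defect. *)
Lemma eq_of_sub_eq (V : zmodType) (s t u v : V) :
  s = t -> u - v = s - t -> u = v.
Proof. by move=> ->; rewrite subrr => /subr0_eq. Qed.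

Definition lfun_lin :=
  (add_lfunE, opp_lfunE, zero_lfunE, comp_lfunE, lfunDr, lfunNr, lfun0r).

(** * The bicrossed product on a direct sum, and the matched pair it yields *)

Section BicrossedSum.
Variables (K : fieldType) (P1 P2 : vectType K).
Notation Q := (P1 * P2)%type.
Implicit Types (x y : P1) (a b : P2) (u v : Q).

Definition inj1 x : Q := (x, 0).
Definition inj2 a : Q := (0, a).

Section Product.
Variables (m1 : 'Hom(P1, 'End(P1))) (m2 : 'Hom(P2, 'End(P2))).
Variables (L R : 'Hom(P1, 'End(P2))) (L' R' : 'Hom(P2, 'End(P1))).

(** The product of a matched pair of associative algebras. A Lie bracket is the case [R = - L],
    [R' = - L'], so one definition serves both operations. *)
Definition bicrossed : 'Hom(Q, 'End(Q)) :=
  blin (fun u v : Q =>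
    (m1 u.1 v.1 + L' u.2 v.1 + R' v.2 u.1,
     m2 u.2 v.2 + L u.1 v.2 + R v.1 u.2)).

Lemma bicrossedE u v :
  bicrossed u v =
    (m1 u.1 v.1 + L' u.2 v.1 + R' v.2 u.1,
     m2 u.2 v.2 + L u.1 v.2 + R v.1 u.2).
Proof.
rewrite blinE//; split=> w c s t; congr pair => /=;
 by rewrite !lfunPl !lfunPr !scalerDr (addrACA (c *: _)) [LHS]addrACA.
Qed.

Lemma bicrossed1l x v :
  bicrossed (inj1 x) v = (m1 x v.1 + R' v.2 x, L x v.2).
Proof. by rewrite bicrossedE /= !(lfun0r, lfun0l) ?addr0 ?add0r. Qed.

Lemma bicrossed2l a v :
  bicrossed (inj2 a) v = (L' a v.1, m2 a v.2 + R v.1 a).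
Proof. by rewrite bicrossedE /= !(lfun0r, lfun0l) ?addr0 ?add0r. Qed.

Lemma bicrossed1r u x :
  bicrossed u (inj1 x) = (m1 u.1 x + L' u.2 x, R x u.2).
Proof. by rewrite bicrossedE /= !(lfun0r, lfun0l) ?addr0 ?add0r. Qed.

Lemma bicrossed2r u a :
  bicrossed u (inj2 a) = (R' a u.1, m2 u.2 a + L u.1 a).
Proof. by rewrite bicrossedE /= !(lfun0r, lfun0l) ?addr0 ?add0r. Qed.

Lemma bicrossed11 x y : bicrossed (inj1 x) (inj1 y) = inj1 (m1 x y).
Proof. by rewrite bicrossed1l /= !(lfun0r, lfun0l) !addr0. Qed.

Lemma bicrossed22 a b : bicrossed (inj2 a) (inj2 b) = inj2 (m2 a b).
Proof. by rewrite bicrossed2l /= !(lfun0r, lfun0l) !addr0. Qed.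

Lemma bicrossed12 x a : bicrossed (inj1 x) (inj2 a) = (R' a x, L x a).
Proof. by rewrite bicrossed1l /= !(lfun0r, lfun0l) add0r. Qed.

Lemma bicrossed21 a x : bicrossed (inj2 a) (inj1 x) = (L' a x, R x a).
Proof. by rewrite bicrossed2l /= !(lfun0r, lfun0l) add0r. Qed.

End Product.

Definition bicrossed_hom :=
  (bicrossed11, bicrossed22, bicrossed12, bicrossed21).

Definition bicrossed_half :=
  (bicrossed1l, bicrossed2l, bicrossed1r, bicrossed2r).

Ltac component1 H :=
  have /(congr1 (@fst P1 P2)) := H;
  rewrite !bicrossed_hom ?bicrossed_half /=.

Ltac component2 H :=
  have /(congr1 (@snd P1 P2)) := H;
  rewrite !bicrossed_hom ?bicrossed_half /=.

(* ring only works on scalars, hence the detour through a functional. *)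
Ltac linear_consequence :=
  let d := fresh "d" in let E := fresh "E" in
  move=> E; apply: dual_inj => d; move/(congr1 (fun_of_lfun d)): E;
  rewrite !lfun_lin => E;
  first [by apply: (eq_of_sub_eq E); ring
        | by apply: (eq_of_sub_eq (esym E)); ring].

(** Each axiom of the double is evaluated at two elements of one summand and one of the other. The
    component in the summand of the single element is a representation axiom; the component in the
    summand of the other two is a compatibility condition. *)
Lemma ncPoisson_bicrossed_matched_pair
    (m1 k1 : 'Hom(P1, 'End(P1))) (m2 k2 : 'Hom(P2, 'End(P2)))
    (L R rho : 'Hom(P1, 'End(P2))) (L' R' rho' : 'Hom(P2, 'End(P1))) :
  ncPoisson (bicrossed m1 m2 L R L' R')
    (bicrossed k1 k2 rho (- rho) rho' (- rho')) ->
  matched_pair m1 k1 m2 k2 L R rho L' R' rho'.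
Proof.
case=> mA alt jac leib.
have alt1 x : k1 x x = 0 by have := alt (inj1 x); rewrite bicrossed11 => -[].
have alt2 a : k2 a a = 0 by have := alt (inj2 a); rewrite bicrossed22 => -[].
have N1 := alt_antisym alt1; have N2 := alt_antisym alt2.
split.
- split=> //.
  + by move=> x y z; component1 (mA (inj1 x) (inj1 y) (inj1 z)).
  + by move=> x y z; component1 (jac (inj1 x) (inj1 y) (inj1 z)).
  + by move=> x y z; component1 (leib (inj1 x) (inj1 y) (inj1 z)).
- split=> //.
  + by move=> x y z; component2 (mA (inj2 x) (inj2 y) (inj2 z)).
  + by move=> x y z; component2 (jac (inj2 x) (inj2 y) (inj2 z)).
  + by move=> x y z; component2 (leib (inj2 x) (inj2 y) (inj2 z)).
- split=> x y; apply/lfunP=> a; rewrite !lfun_lin.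
  + by component2 (mA (inj1 x) (inj1 y) (inj2 a)).
  + by component2 (mA (inj2 a) (inj1 x) (inj1 y)).
  + by component2 (mA (inj1 x) (inj2 a) (inj1 y)).
  + by component2 (jac (inj1 x) (inj1 y) (inj2 a)); linear_consequence.
  + by component2 (leib (inj1 x) (inj1 y) (inj2 a)); linear_consequence.
  + by component2 (leib (inj1 x) (inj2 a) (inj1 y)); linear_consequence.
  + by component2 (leib (inj2 a) (inj1 x) (inj1 y)); linear_consequence.
- split=> x y; apply/lfunP=> a; rewrite !lfun_lin.
  + by component1 (mA (inj2 x) (inj2 y) (inj1 a)).
  + by component1 (mA (inj1 a) (inj2 x) (inj2 y)).
  + by component1 (mA (inj2 x) (inj1 a) (inj2 y)).
  + by component1 (jac (inj2 x) (inj2 y) (inj1 a)); linear_consequence.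
  + by component1 (leib (inj2 x) (inj2 y) (inj1 a)); linear_consequence.
  + by component1 (leib (inj2 x) (inj1 a) (inj2 y)); linear_consequence.
  + by component1 (leib (inj1 a) (inj2 x) (inj2 y)); linear_consequence.
(* The Jacobi identity produces this bracket with its arguments exchanged. Antisymmetry is not a
   linear consequence of it, so it is applied beforehand. *)
- move=> x y a; rewrite (N1 (rho' a x) y).
  by component1 (jac (inj1 x) (inj1 y) (inj2 a)); linear_consequence.
- move=> x a b; rewrite (N2 (rho x a) b).
  by component2 (jac (inj2 a) (inj2 b) (inj1 x)); linear_consequence.
- by move=> x a b; component2 (mA (inj1 x) (inj2 a) (inj2 b));
     linear_consequence.
- by move=> x a b; component2 (mA (inj2 a) (inj2 b) (inj1 x));
     linear_consequence.
- by move=> x y a; component1 (mA (inj2 a) (inj1 x) (inj1 y));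
     linear_consequence.
- by move=> x y a; component1 (mA (inj1 x) (inj1 y) (inj2 a));
     linear_consequence.
- by move=> x a b; component2 (mA (inj2 a) (inj1 x) (inj2 b));
     linear_consequence.
- by move=> x y a; component1 (mA (inj1 x) (inj2 a) (inj1 y));
     linear_consequence.
- by move=> x a b; component2 (leib (inj1 x) (inj2 a) (inj2 b));
     linear_consequence.
- by move=> x a b; component2 (leib (inj2 a) (inj1 x) (inj2 b));
     linear_consequence.
- by move=> x y a; component1 (leib (inj2 a) (inj1 x) (inj1 y));
     linear_consequence.
- by move=> x y a; component1 (leib (inj1 x) (inj2 a) (inj1 y));
     linear_consequence.
Qed.
End BicrossedSum.

(** * Poisson axioms tested against an invariant form *)

Section InvariantForm.
Variables (K : fieldType) (Q : vectType K) (B : Q -> Q -> K).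
Hypothesis B_sym : forall u v, B u v = B v u.
Hypothesis B_add : forall u v w, B (u + v) w = B u w + B v w.
Hypothesis B_nondeg : forall u, (forall v, B u v = 0) -> u = 0.
Implicit Types m k : 'Hom(Q, 'End(Q)).

Lemma invariant_form0 w : B 0 w = 0.
Proof. by apply: (addrI (B 0 w)); rewrite -B_add !addr0. Qed.

Lemma invariant_formN u w : B (- u) w = - B u w.
Proof. by apply: (addrI (B u w)); rewrite -B_add !subrr invariant_form0. Qed.

Lemma nondeg_inj u v : (forall w, B u w = B v w) -> u = v.
Proof.
move=> uv; apply/eqP; rewrite -subr_eq0; apply/eqP/B_nondeg => w.
by rewrite B_add invariant_formN uv subrr.
Qed.

(** Pairing a defect with an arbitrary [z] and moving one factor across [B] by invariance gives one
    of these forms. Nothing is lost, since [B] is nondegenerate. *)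
Lemma invariant_ncPoisson m k :
    (forall u v w, B (m u v) w = B u (m v w)) ->
    (forall u v w, B (k u v) w = B u (k v w)) ->
    (forall u, k u u = 0) ->
    (forall u v w z, B (m u v) (m w z) - B (m v w) (m z u) = 0) ->
    (forall u v w z,
      B (k v w) (k u z) + B (k w u) (k v z) + B (k u v) (k w z) = 0) ->
    (forall u v w z,
      B (m v w) (k u z) + B (m w z) (k u v) + B (m z v) (k u w) = 0) ->
  ncPoisson m k.
Proof.
move=> m_inv k_inv alt assoc jac leib.
have kC := alt_antisym alt.
split=> // u v w; apply: nondeg_inj => z.
- rewrite m_inv (B_sym (m u (m v w))) -(m_inv z) (B_sym (m z u)).
  by apply/eqP; rewrite -subr_eq0 assoc.
- rewrite (kC u (k v w)) (kC v (k w u)) (kC w (k u v)) -!opprD invariant_formN.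
  rewrite !B_add (k_inv (k v w)) (k_inv (k w u)) (k_inv (k u v)) jac.
  by rewrite invariant_form0 oppr0.
- rewrite (kC u (m v w)) invariant_formN (k_inv (m v w)) B_add (m_inv (k u v)).
  rewrite (B_sym (m v (k u w))) -(m_inv z) (B_sym (k u v)).
  by apply: (eq_of_sub_eq (esym (leib u v w z))); ring.
Qed.

End InvariantForm.

(** * Vanishing of cyclic and anticyclic forms on a direct sum *)

Section CyclicForms.
Variables (K : fieldType) (P D : vectType K).
Notation Q := (P * D)%type.
Implicit Types (x y : P) (a b c d : D) (u v w s t : Q).

Notation inj1 := (@inj1 K P D).
Notation inj2 := (@inj2 K P D).

Definition part (i : bool) u : Q := if i then inj2 u.2 else inj1 u.1.

Lemma part_sum u : u = part false u + part true u.
Proof. by case: u => x a; congr pair; rewrite /= ?addr0 ?add0r. Qed.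

(** Rotation carries additivity from the first slot to the others, so [T] splits over the eight
    choices of summands. These form four rotation classes, each represented by one hypothesis. *)
Lemma cyclic_form3_eq0 (T : Q -> Q -> Q -> K) :
    (forall u u' v w, T (u + u') v w = T u v w + T u' v w) ->
    (forall u v w, T u v w = T v w u) ->
    (forall x y z, T (inj1 x) (inj1 y) (inj1 z) = 0) ->
    (forall x y a, T (inj1 x) (inj1 y) (inj2 a) = 0) ->
    (forall x a b, T (inj1 x) (inj2 a) (inj2 b) = 0) ->
    (forall a b c, T (inj2 a) (inj2 b) (inj2 c) = 0) ->
  forall u v w, T u v w = 0.
Proof.
move=> D1 rot T111 T112 T122 T222 u v w.
have D2 s t t' r : T s (t + t') r = T s t r + T s t' r.
  by rewrite rot D1 -!(rot s).
have D3 s t r r' : T s t (r + r') = T s t r + T s t r'.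
  by rewrite rot D2 -!(rot s).
have T0 i j k : T (part i u) (part j v) (part k w) = 0.
  by case: i j k => [] [] [] /=; do 3?[by []|rewrite rot].
rewrite (part_sum u) (part_sum v) (part_sum w) !(D1, D2, D3) !T0.
by rewrite !addr0.
Qed.

(** As for three arguments: the sixteen choices of summands form six rotation classes, and a sign
    does not affect vanishing. Two classes have two arguments in each summand: the adjacent and the
    alternating one. *)
Lemma anticyclic_form4_eq0 (T : Q -> Q -> Q -> Q -> K) :
    (forall u u' v w z, T (u + u') v w z = T u v w z + T u' v w z) ->
    (forall u v w z, T u v w z = - T v w z u) ->
    (forall x y z x', T (inj1 x) (inj1 y) (inj1 z) (inj1 x') = 0) ->
    (forall x y z a, T (inj1 x) (inj1 y) (inj1 z) (inj2 a) = 0) ->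
    (forall x y a b, T (inj1 x) (inj1 y) (inj2 a) (inj2 b) = 0) ->
    (forall x a y b, T (inj1 x) (inj2 a) (inj1 y) (inj2 b) = 0) ->
    (forall x a b c, T (inj1 x) (inj2 a) (inj2 b) (inj2 c) = 0) ->
    (forall a b c d, T (inj2 a) (inj2 b) (inj2 c) (inj2 d) = 0) ->
  forall u v w z, T u v w z = 0.
Proof.
move=> D1 rot T1111 T1112 T1122 T1212 T1222 T2222 u v w z.
have D2 s t t' r q : T s (t + t') r q = T s t r q + T s t' r q.
  by rewrite rot D1 opprD -!(rot s).
have D3 s t r r' q : T s t (r + r') q = T s t r q + T s t r' q.
  by rewrite rot D2 opprD -!(rot s).
have D4 s t r q q' : T s t r (q + q') = T s t r q + T s t r q'.
  by rewrite rot D3 opprD -!(rot s).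
have T0 i j k h : T (part i u) (part j v) (part k w) (part h z) = 0.
  by apply/eqP; case: i j k h => [] [] [] [] /=;
     do 4?[by apply/eqP|rewrite rot oppr_eq0].
rewrite (part_sum u) (part_sum v) (part_sum w) (part_sum z).
by rewrite !(D1, D2, D3, D4) !T0 !addr0.
Qed.

End CyclicForms.

(* Operations are plain functions here: the vector space structures that
   dual P receives from 'Hom(P, K^o) are convertible but costly to compare. *)
Section PairedConditions.
Variables (K : nzRingType) (P D : Type) (e : D -> P -> K).
Implicit Types (m k : P -> P -> P) (n l : D -> D -> D).

(** The mixed operations are plain transposes of the two products. This describes [-R^*] and [-L^*]
    without signs; for a bracket the same equations describe [ad^*] and [-ad^*], because -<a, {x,
    y}> = <a, {y, x}>. *)
Record coadjoint m n (L R : P -> D -> D) (L' R' : D -> P -> P) : Prop :=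
  Coadjoint {
  coadj_L : forall x a y, e (L x a) y = e a (m y x);
  coadj_R : forall x a y, e (R x a) y = e a (m x y);
  coadj_L' : forall a x b, e b (L' a x) = e (n b a) x;
  coadj_R' : forall a x b, e b (R' a x) = e (n a b) x }.

(* Conditions (b) and (c) of a bialgebra, paired with a (x) b. *)
Record bialgebra_pairing m k n l (L R Lk Rk : P -> D -> D) : Prop :=
  BialgebraPairing {
  bp_Delta_mul : forall x y a b,
    e (n a b) (m x y) = e (n (L y a) b) x + e (n a (R x b)) y;
  bp_Delta_sym : forall x y a b,
    e (n b (L x a)) y + e (n a (L y b)) x
    - (e (n (R y a) b) x + e (n (R x b) a) y) = 0;
  bp_delta_br : forall x y a b,
    e (l a b) (k x y) + e (l a (Lk x b)) y + e (l b (Lk y a)) x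
    + e (l (Lk y b) a) x + e (l b (Rk x a)) y = 0;
  bp_Delta_br : forall x y a b,
    e (n a b) (k x y) + e (n a (Lk x b)) y + e (l b (L y a)) x
    + e (n (Lk x a) b) y + e (l a (R y b)) x = 0;
  bp_delta_mul : forall x y a b,
    e (l a b) (m x y) + e (n b (Rk x a)) y + e (l (L y b) a) x
    + e (n (Rk y a) b) x + e (l (R x b) a) y = 0 }.

End PairedConditions.

(** * The double of a coadjoint pair and its natural form *)

Local Notation op m := (fun x y => fun_of_lfun (fun_of_lfun m x) y).

(* P and D stand for a space and its dual, with evaluation e; keeping D abstract
   keeps unification away from the coordinates that define dual spaces. *)
Section CoadjointSum.
Variables (K : fieldType) (P D : vectType K) (e : D -> P -> K).
Hypothesis e_addl : forall a b x, e (a + b) x = e a x + e b x.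
Hypothesis e_addr : forall a x y, e a (x + y) = e a x + e a y.
Hypothesis e_injl : forall a, (forall x, e a x = 0) -> a = 0.
Hypothesis e_injr : forall x, (forall a, e a x = 0) -> x = 0.
Implicit Types (m k : 'Hom(P, 'End(P))) (n l : 'Hom(D, 'End(D))).
Implicit Types (x y : P) (a b c d : D).
Notation Q := (P * D)%type.
Local Notation i1 := (@inj1 K P D).
Local Notation i2 := (@inj2 K P D).

Lemma pairing0l x : e 0 x = 0.
Proof. by apply: (addrI (e 0 x)); rewrite -e_addl !addr0. Qed.

Lemma pairing0r a : e a 0 = 0.
Proof. by apply: (addrI (e a 0)); rewrite -e_addr !addr0. Qed.

Lemma pairingNl a x : e (- a) x = - e a x.
Proof. by apply: (addrI (e a x)); rewrite -e_addl !subrr pairing0l. Qed.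

Lemma pairingNr a x : e a (- x) = - e a x.
Proof. by apply: (addrI (e a x)); rewrite -e_addr !subrr pairing0r. Qed.

Definition pairing_form (u v : Q) : K := e v.2 u.1 + e u.2 v.1.
Notation B := pairing_form.

Lemma pairing_form_sym u v : B u v = B v u.
Proof. by rewrite /B addrC. Qed.

Lemma pairing_form_add u v w : B (u + v) w = B u w + B v w.
Proof. by rewrite /B e_addr e_addl addrACA. Qed.

Lemma pairing_form_addr u v w : B u (v + w) = B u v + B u w.
Proof. by rewrite !(pairing_form_sym u) pairing_form_add. Qed.

(* The invariant form of the Leibniz defect {u, vw} - {u, v}w - v{u, w},
   up to sign; it is cyclic in v, w, z. *)
Definition leibniz_form (M N : 'Hom(Q, 'End(Q))) u v w z : K :=
  B (M v w) (N u z) + B (M w z) (N u v) + B (M z v) (N u w).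

Lemma leibniz_form_addl M N u u' v w z :
  leibniz_form M N (u + u') v w z =
    leibniz_form M N u v w z + leibniz_form M N u' v w z.
Proof. by rewrite /leibniz_form !lfunDl !pairing_form_addr; ring. Qed.

Lemma leibniz_form_addr M N u v v' w z :
  leibniz_form M N u (v + v') w z =
    leibniz_form M N u v w z + leibniz_form M N u v' w z.
Proof.
rewrite /leibniz_form lfunDl !lfunDr !pairing_form_add pairing_form_addr; ring.
Qed.

Lemma leibniz_form_cyclic M N u v w z :
  leibniz_form M N u v w z = leibniz_form M N u w z v.
Proof. by rewrite /leibniz_form; ring. Qed.

Lemma pairing_form_nondeg u : (forall v, B u v = 0) -> u = 0.
Proof.
case: u => x a uB; congr pair.
  by apply: e_injr => b; have := uB (i2 b); rewrite /B /= pairing0r addr0.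
by apply: e_injl => y; have := uB (i1 y); rewrite /B /= pairing0l add0r.
Qed.

Section Form.
Variables (m : 'Hom(P, 'End(P))) (n : 'Hom(D, 'End(D))).
Variables (L R : 'Hom(P, 'End(D))) (L' R' : 'Hom(D, 'End(P))).
Hypothesis coadj : coadjoint e (op m) (op n) (op L) (op R) (op L') (op R').
Notation M := (bicrossed m n L R L' R').

(** The right-hand side is visibly unchanged when [u], [v], [w] are rotated; with the symmetry of
    [B], this is invariance. *)
Lemma coadjoint_sum_form u v w :
  B (M u v) w =
    e w.2 (m u.1 v.1) + e u.2 (m v.1 w.1) + e v.2 (m w.1 u.1)
    + (e (n u.2 v.2) w.1 + e (n v.2 w.2) u.1 + e (n w.2 u.2) v.1).
Proof.
case: coadj => /= LE RE L'E R'E.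
rewrite /B bicrossedE /= !e_addr !e_addl L'E R'E LE RE; ring.
Qed.

Lemma coadjoint_sum_invariant u v w : B (M u v) w = B u (M v w).
Proof. by rewrite (pairing_form_sym u) !coadjoint_sum_form; ring. Qed.

(** Paired with any [v], the square of [u] leaves terms such as
    [e u.2 (m u.1 v.1) + e u.2 (m v.1 u.1)], which cancel by antisymmetry. *)
Lemma coadjoint_sum_alt :
  (forall x, m x x = 0) -> (forall a, n a a = 0) -> forall u, M u u = 0.
Proof.
move=> /[dup] /alt_antisym mC altm /[dup] /alt_antisym nC altn u.
apply: pairing_form_nondeg => v; rewrite coadjoint_sum_form altm altn.
rewrite (mC v.1) (nC v.2) pairing0r pairing0l pairingNr pairingNl; ring.
Qed.

(* Invariance determines the mixed products. *)
Lemma coadjoint_sum_unique (N : 'Hom(Q, 'End(Q))) :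
    (forall u v w, B (N u v) w = B u (N v w)) ->
    (forall x y, N (i1 x) (i1 y) = i1 (m x y)) ->
    (forall a b, N (i2 a) (i2 b) = i2 (n a b)) ->
  N = M.
Proof.
move=> N_inv N11 N22; apply/lfunP => u; apply/lfunP => v.
apply: (nondeg_inj pairing_form_add pairing_form_nondeg) => w.
apply/eqP; rewrite -subr_eq0; apply/eqP; move: u v w.
(* The difference of the two trilinear forms is cyclic by invariance. Up to rotation, every pattern
   starts or ends with two arguments in the same summand, where the product is prescribed. *)
apply: cyclic_form3_eq0 => [u u' v w|u v w|x y z|x y a|x a b|a b c].
- by rewrite !lfunDl !pairing_form_add; ring.
- by rewrite N_inv coadjoint_sum_invariant !(pairing_form_sym u).
- by rewrite N11 bicrossed11 subrr.
- by rewrite N11 bicrossed11 subrr.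
- by rewrite N_inv coadjoint_sum_invariant N22 bicrossed22 subrr.
- by rewrite N22 bicrossed22 subrr.
Qed.

End Form.

Lemma coadjoint_sum_ncPoisson m k n l (L R Lk Rk : 'Hom(P, 'End(D)))
    (L' R' Lk' Rk' : 'Hom(D, 'End(P))) :
    coadjoint e (op m) (op n) (op L) (op R) (op L') (op R') ->
    coadjoint e (op k) (op l) (op Lk) (op Rk) (op Lk') (op Rk') ->
    ncPoisson m k -> coherent m k -> ncPoisson n l -> coherent n l ->
    bialgebra_pairing e (op m) (op k) (op n) (op l)
      (op L) (op R) (op Lk) (op Rk) ->
  ncPoisson (bicrossed m n L R L' R') (bicrossed k l Lk Rk Lk' Rk').
Proof.
move=> cm ck [mA kalt kJ kL] kcoh [nA lalt lJ lL] lcoh [] /= b1 b2 b3 b4 b5.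
have kC := alt_antisym kalt; have lC := alt_antisym lalt.
have alt := coadjoint_sum_alt ck kalt lalt.
have C := alt_antisym alt.
have invm := coadjoint_sum_invariant cm.
have invk := coadjoint_sum_invariant ck.
case: (cm) (ck) => /= LE RE L'E R'E [] /= LkE RkE Lk'E Rk'E.
have BNl u v : B (- u) v = - B u v by exact: (invariant_formN pairing_form_add).
have BNr u v : B u (- v) = - B u v by rewrite !(pairing_form_sym u) BNl.
pose lin := (lfunDl, lfunDr, pairing_form_add, pairing_form_addr).
have BE u v : B u v = e v.2 u.1 + e u.2 v.1 by [].
pose hom := (bicrossed_hom, BE).
pose ev := (L'E, R'E, Lk'E, Rk'E).
pose ev' := (LE, RE, LkE, RkE).
pose F := leibniz_form (bicrossed m n L R L' R') (bicrossed k l Lk Rk Lk' Rk').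
pose z0 := (pairing0l, pairing0r).
apply: (invariant_ncPoisson pairing_form_sym pairing_form_add
  pairing_form_nondeg) => //.
(* Associativity. Arguments all in one summand give zero because the summand is isotropic; a single
   argument in the other one gives associativity of [P] or [D]. The adjacent mixed pattern is [b1],
   the alternating one [b2]. *)
- apply: anticyclic_form4_eq0 =>
    [u u' v w z|u v w z|x y z t|x y z a|x y a b|x a y b|x a b c|a b c d].
  + by rewrite !lin; ring.
  + by rewrite (pairing_form_sym (bicrossed m n L R L' R' w z)); ring.
  + by rewrite !hom /= ?z0; ring.
  + by rewrite !hom /= ?z0 !ev' mA; ring.
  + by rewrite !hom /= ?z0 !ev b1; ring.
  + by rewrite !hom /= ?z0 !ev b2.
  + by rewrite !hom /= ?z0 !ev nA; ring.
  + by rewrite !hom /= ?z0; ring.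
(* Jacobi. Here antisymmetry merges the two mixed patterns: both follow from [b3], with [x] and [y]
   exchanged in the alternating one. *)
- apply: anticyclic_form4_eq0 =>
    [u u' v w z|u v w z|x y z t|x y z a|x y a b|x a y b|x a b c|a b c d].
  + by rewrite !lin; ring.
  + rewrite (C v u) (C z v) (C z u) !BNr !BNl.
    by rewrite !(pairing_form_sym (bicrossed k l _ _ _ _ w _)); ring.
  + by rewrite !hom /= ?z0; ring.
  + rewrite !hom /= ?z0 !ev'.
    have J : e a (k x (k y z)) + e a (k y (k z x)) + e a (k z (k x y)) = 0.
      by rewrite -!e_addr kJ pairing0r.
    rewrite (kC (k y z)) (kC (k z x)) (kC (k x y)) !pairingNr.
    by apply: (eq_of_sub_eq (esym J)); ring.
  + rewrite !hom /= ?z0 !ev.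
    by apply: (eq_of_sub_eq (b3 x y a b)); ring.
  + rewrite !hom /= ?z0 !ev.
    by apply: (eq_of_sub_eq (b3 y x a b)); ring.
  + rewrite !hom /= ?z0 !ev.
    have J : e (l a (l b c)) x + e (l b (l c a)) x + e (l c (l a b)) x = 0.
      by rewrite -!e_addl lJ pairing0l.
    rewrite (lC (l a c)) (lC a c) lfunNr opprK.
    by apply: (eq_of_sub_eq J); ring.
  + by rewrite !hom /= ?z0; ring.
(* Leibniz. The rotation fixes [u], so the summand of [u] is chosen first and the cyclic lemma is
   applied to [v], [w], [z]. Coherence enters when [u] lies in one summand and the other three
   arguments in the other: the form is then the coherence sum of that other algebra, paired with
   [u]. *)
- have F1 x : forall v w z, F (i1 x) v w z = 0.
    apply: cyclic_form3_eq0 => [v v' w z|v w z|y z t|y z a|y a b|a b c].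
    + exact: leibniz_form_addr.
    + exact: leibniz_form_cyclic.
    + by rewrite /F /leibniz_form !hom /= ?z0; ring.
    + rewrite /F /leibniz_form !hom /= ?z0 !ev'.
      by rewrite (kC (m y z)) pairingNr kL e_addr; ring.
    + rewrite /F /leibniz_form !hom /= ?z0 !ev.
      by apply: (eq_of_sub_eq (b4 x y a b)); ring.
    + rewrite /F /leibniz_form !hom /= ?z0 !ev.
      by rewrite !add0r -!e_addl lcoh pairing0l.
  have F2 a : forall v w z, F (i2 a) v w z = 0.
    apply: cyclic_form3_eq0 => [v v' w z|v w z|x y z|x y b|x b c|b c d].
    + exact: leibniz_form_addr.
    + exact: leibniz_form_cyclic.
    + rewrite /F /leibniz_form !hom /= ?z0 !ev'.
      by rewrite !addr0 -!e_addr kcoh pairing0r.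
    + rewrite /F /leibniz_form !hom /= ?z0 !ev.
      by apply: (eq_of_sub_eq (b5 x y a b)); ring.
    + rewrite /F /leibniz_form !hom /= ?z0 !ev.
      by rewrite (lC (n b c)) pairingNl lL e_addl; ring.
    + by rewrite /F /leibniz_form !hom /= ?z0; ring.
  move=> u v w z; rewrite -[LHS]/(F u v w z).
  have := leibniz_form_addl (bicrossed m n L R L' R')
    (bicrossed k l Lk Rk Lk' Rk') (part false u) (part true u) v w z.
  by rewrite -part_sum -/F F1 F2 addr0.
Qed.
End CoadjointSum.

(** * From matched pairs to the paired bialgebra conditions *)

Section MatchedPairPairing.
Variables (K : fieldType) (P D : vectType K) (e : D -> P -> K).
Hypothesis e_addl : forall a b x, e (a + b) x = e a x + e b x.
Hypothesis e_addr : forall a x y, e a (x + y) = e a x + e a y.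
Hypothesis e_injl : forall a, (forall x, e a x = 0) -> a = 0.
Implicit Types (m k : 'Hom(P, 'End(P))) (n l : 'Hom(D, 'End(D))).

Lemma coadjoint_alt k l (Lk Rk : 'Hom(P, 'End(D)))
    (Lk' Rk' : 'Hom(D, 'End(P))) :
    (forall x, k x x = 0) ->
    coadjoint e (op k) (op l) (op Lk) (op Rk) (op Lk') (op Rk') ->
  forall x a, Rk x a = - Lk x a.
Proof.
move=> /alt_antisym kC [] /= LkE RkE _ _ x a.
apply/eqP; rewrite -addr_eq0; apply/eqP/e_injl => y.
by rewrite e_addl LkE RkE kC (pairingNr e_addr) addNr.
Qed.

(** Each identity is a matched pair condition with values in [D], evaluated at a point of [P] and
    then freed of primed actions by transposition. *)
Lemma matched_pair_bialgebra_pairing m k n l (L R Lk Rk : 'Hom(P, 'End(D)))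
    (L' R' Lk' Rk' : 'Hom(D, 'End(P))) :
    coadjoint e (op m) (op n) (op L) (op R) (op L') (op R') ->
    coadjoint e (op k) (op l) (op Lk) (op Rk) (op Lk') (op Rk') ->
    matched_pair m k n l L R Lk L' R' Lk' ->
  bialgebra_pairing e (op m) (op k) (op n) (op l)
    (op L) (op R) (op Lk) (op Rk).
Proof.
move=> cm ck mp.
have kC := alt_antisym (ncp_alt (mp_alg1 mp)).
have lC := alt_antisym (ncp_alt (mp_alg2 mp)).
have RLk := coadjoint_alt (ncp_alt (mp_alg1 mp)) ck.
case: cm ck => /= LE RE L'E R'E [] /= LkE RkE Lk'E Rk'E.
have N := (pairingNl e_addl, pairingNr e_addr).
have e0l := pairing0l e_addl.
split=> x y a b /=.
- have /(congr1 (e^~ x)) /= := mp_ass1 mp y a b.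
  (* Used backwards, [RE] frees the primed action from the product of [P]; [R'E] then turns it into
     a product of [D]. *)
  by rewrite e_addl !LE -(RE x b) R'E addrC => ->.
- have /(congr1 (e^~ y)) /= := mp_ass5 mp x b a.
  rewrite e0l !(e_addl, N) LE RE -(RE y a) L'E -(LE y b) R'E => E.
  by apply: (eq_of_sub_eq (esym E)); ring.
- have /(congr1 (e^~ y)) /= := mp_lie2 mp x a b.
  rewrite !(e_addl, N) !LkE -(RkE y b) -(RkE y a) !Lk'E => E.
  (* For [ring] the values of [e] are atoms, so both identities are first brought to the same atoms
     by antisymmetry and [Rk = - Lk]. *)
  rewrite !RLk !lfunNl !N in E.
  rewrite (kC x) (lC b (Lk y a)) RLk lfunNr (lC b (Lk x a)) opprK !N.
  by apply: (eq_of_sub_eq (esym E)); ring.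
- have /(congr1 (e^~ y)) /= := mp_mix1 mp x a b.
  rewrite !(e_addl, N) !LkE LE RE -(RE y b) -(LE y a) !Lk'E => E.
  rewrite (kC x) (lC b) (lC a (R y b)) !N.
  by apply: (eq_of_sub_eq (esym E)); ring.
- have /(congr1 (e^~ x)) /= := mp_mix2 mp y a b.
  rewrite !(e_addl, N) !LE LkE -(RkE x a) -(RE x b) R'E Lk'E => E.
  rewrite RLk lfunNr N in E; rewrite !RLk lfunNr lfunNl (lC (L y b)) !N.
  by apply: (eq_of_sub_eq E); ring.
Qed.
End MatchedPairPairing.

(** * Pairing tensors with pairs of functionals *)

Section TensorPairing.
Variables (K : fieldType) (P : vectType K).
Implicit Types (a b : dual P) (f g : 'End(P)) (t : tensor P P).

Lemma tpair_tmap a b f g t :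
  tpair a b (tmap f g t) = tpair (a \o f)%VF (b \o g)%VF t.
Proof.
rewrite -comp_lfunE; congr (fun_of_lfun _ t); apply: tlift_uniq => x y.
by rewrite comp_lfunE tmapE !tpairE !comp_lfunE.
Qed.

Lemma tpair_tau a b t : tpair a b (tau P P t) = tpair b a t.
Proof.
rewrite -comp_lfunE; congr (fun_of_lfun _ t); apply: tlift_uniq => x y.
by rewrite comp_lfunE tauE !tpairE mulrC.
Qed.

(** Pairing with two coordinate functionals reads off an entry of the matrix that represents the
    tensor. *)
Lemma tpair_inj (s t : tensor P P) :
  (forall a b, tpair a b s = tpair a b t) -> s = t.
Proof.
have entry i j (r : 'M[K]_(\dim {:P}, \dim {:P})) :
    r i j = tpair (vcoord i) (vcoord j) (r : tensor P P).
  pose f : 'Hom(tensor P P, K^o) :=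
    linfun (fun q : 'M[K]_(\dim {:P}, \dim {:P}) => q i j : K^o).
  have fE q : f q = (q : 'M_(_, _)) i j.
    by rewrite linfunE// => c u v; rewrite !mxE.
  suff -> : tpair (vcoord i) (vcoord j) = f by rewrite fE.
  by apply: tlift_uniq => x y; rewrite fE tpairE mxE.
move=> st; apply/matrixP => i j; rewrite !entry; exact: st.
Qed.

Lemma tpairD a b (s t : tensor P P) :
  tpair a b (s + t) = tpair a b s + tpair a b t.
Proof. exact: lfunDr. Qed.

Lemma tpairN a b t : tpair a b (- t) = - tpair a b t.
Proof. exact: lfunNr. Qed.

Lemma tpairNl a b t : tpair (- a) b t = - tpair a b t.
Proof.
rewrite -opp_lfunE; congr (fun_of_lfun _ t); apply: tlift_uniq => x y.
by rewrite opp_lfunE !tpairE opp_lfunE mulNr.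
Qed.

Lemma tpairNr a b t : tpair a (- b) t = - tpair a b t.
Proof. by rewrite -tpair_tau tpairNl tpair_tau. Qed.

Lemma tpair_add a b (f g : 'End(tensor P P)) t :
  tpair a b ((f + g)%VF t) = tpair a b (f t) + tpair a b (g t).
Proof. by rewrite add_lfunE tpairD. Qed.

Lemma tpair_sub a b (f g : 'End(tensor P P)) t :
  tpair a b ((f - g)%VF t) = tpair a b (f t) - tpair a b (g t).
Proof. by rewrite tpair_add opp_lfunE tpairN. Qed.

Lemma tpair0 a b : tpair a b 0 = 0.
Proof. exact: lfun0r. Qed.

End TensorPairing.

(** * The bialgebra conditions as scalar identities *)

Section BialgebraPairing.
Variables (K : fieldType) (P : vectType K).
Variables (mul br : 'Hom(P, 'End(P))) (Delta delta : 'Hom(P, tensor P P)).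
Notation n := (dualprod Delta).
Notation l := (dualprod delta).
Variables (L R Lk Rk : 'Hom(P, 'End(dual P))).
Hypothesis LE : forall x a y, L x a y = a (mul y x).
Hypothesis RE : forall x a y, R x a y = a (mul x y).
Hypothesis LkE : forall x a y, Lk x a y = a (br y x).
Hypothesis RkE : forall x a y, Rk x a y = a (br x y).
Implicit Types (a b : dual P) (x y : P).

Lemma comp_coadjL x a : (a \o flip mul x)%VF = L x a.
Proof. by apply/lfunP => y; rewrite comp_lfunE flipE LE. Qed.

Lemma comp_coadjR x a : (a \o mul x)%VF = R x a.
Proof. by apply/lfunP => y; rewrite comp_lfunE RE. Qed.

Lemma comp_coadjRk x a : (a \o br x)%VF = Rk x a.
Proof. by apply/lfunP => y; rewrite comp_lfunE RkE. Qed.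

Definition tpairing :=
  (tpair_sub, tpair_add, tpairD, tpairN, tpair_tau, tpair_tmap, tpair0,
   comp_lfun1r, comp_coadjL, comp_coadjR, comp_coadjRk).

Lemma bialgebra_pairingP :
    ncPoisson mul br -> coherent mul br -> (forall x, delta x \in wedge2 P) ->
    ncPoisson n l -> coherent n l ->
  bialgebra_pairing (fun (a : dual P) (x : P) => a x : K)
    (op mul) (op br) (op n) (op l) (op L) (op R) (op Lk) (op Rk) <->
  ncp_bialgebra mul br Delta delta.
Proof.
move=> mP mcoh dw nP ncoh.
have nE a b x : n a b x = tpair a b (Delta x) by exact: dualprodE.
have lE a b x : l a b x = tpair a b (delta x) by exact: dualprodE.
have lC x a b : tpair b a (delta x) = - tpair a b (delta x).
  by rewrite -!lE (alt_antisym (ncp_alt nP)) opp_lfunE.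
have LkN x a : Lk x a = - Rk x a.
  apply/lfunP => y; rewrite opp_lfunE LkE RkE (alt_antisym (ncp_alt mP)).
  exact: lfunNr.
(* Each of [D1] to [D5] identifies a scalar defect with the pairing of a tensor defect, up to a sign
   in [D2] and the order of the functionals in [D5]. Both directions then follow, since pairings
   separate tensors. *)
have D1 x y a b :
    n a b (mul x y) - (n (L y a) b x + n a (R x b) y) =
    tpair a b (Delta (mul x y) -
      (tmap \1 (mul x) (Delta y) + tmap (flip mul y) \1 (Delta x))).
  by rewrite !(nE, tpairing); ring.
have D2 x y a b :
    n b (L x a) y + n a (L y b) x - (n (R y a) b x + n (R x b) a y) =
    - tpair a b ((tmap (mul y) \1 - tmap \1 (flip mul y))%VF (Delta x)
      + tau P P ((tmap (mul x) \1 - tmap \1 (flip mul x))%VF (Delta y))).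
  by rewrite !(nE, tpairing); ring.
have D3 x y a b :
    l a b (br x y) + l a (Lk x b) y + l b (Lk y a) x + l (Lk y b) a x
      + l b (Rk x a) y =
    tpair a b (delta (br x y) -
      ((tmap (br x) \1 + tmap \1 (br x))%VF (delta y)
       - (tmap (br y) \1 + tmap \1 (br y))%VF (delta x))).
  rewrite !(lE, LkN, tpairNl, tpairNr) !tpairing.
  by rewrite (lC y (Rk x a)) (lC x (Rk y a)) (lC x a (Rk y b)); ring.
have D4 x y a b :
    n a b (br x y) + n a (Lk x b) y + l b (L y a) x + n (Lk x a) b y
      + l a (R y b) x =
    tpair a b (Delta (br x y) -
      ((tmap (br x) \1 + tmap \1 (br x))%VF (Delta y)
       - tmap \1 (mul y) (delta x) + tmap (flip mul y) \1 (delta x))).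
  rewrite !(nE, lE, LkN, tpairNl, tpairNr) !tpairing.
  by rewrite (lC x (L y a)); ring.
have D5 x y a b :
    l a b (mul x y) + n b (Rk x a) y + l (L y b) a x + n (Rk y a) b x
      + l (R x b) a y =
    tpair b a (tmap (mul x) \1 (delta y) + tmap (flip mul y) \1 (delta x)
      + tmap \1 (br x) (Delta y) + tmap \1 (br y) (tau P P (Delta x))
      - delta (mul x y)).
  by rewrite !(nE, lE, tpairing) (lC _ a b); ring.
have sub_inj (s t : tensor P P) :
    (forall a b, tpair a b (s - t) = 0) -> s = t.
  move=> st; apply/eqP; rewrite -subr_eq0; apply/eqP; apply: tpair_inj => a b.
  by rewrite tpair0.
(* The two records list the conditions in different orders: the second and the fourth are
   exchanged. *)
split=> [[] /= b1 b2 b3 b4 b5|[_ _ _ _ _ b1 b2 b3 b4 b5]].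
  apply: NcpBialgebra => // x y; apply: sub_inj => a b.
  - by move: (D1 x y a b); rewrite b1 subrr => <-.
  - by move: (D4 x y a b); rewrite b4 => <-.
  - by move: (D3 x y a b); rewrite b3 => <-.
  - move: (D2 x y a b); rewrite subr0 b2 => /esym/eqP.
    by rewrite oppr_eq0 => /eqP.
  - by move: (D5 x y b a); rewrite b5 => <-.
apply: BialgebraPairing => x y a b /=.
- by apply/eqP; rewrite -subr_eq0 D1 b1 subrr tpair0.
- by rewrite D2 b4 tpair0 oppr0.
- by rewrite D3 b3 subrr tpair0.
- by rewrite D4 b2 subrr tpair0.
- by rewrite D5 b5 subrr tpair0.
Qed.
End BialgebraPairing.

(** * Manin triples on the double *)

Section ManinTriple.
Variables (K : fieldType) (P D : vectType K) (e : D -> P -> K).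
Hypothesis e_addl : forall a b x, e (a + b) x = e a x + e b x.
Hypothesis e_addr : forall a x y, e a (x + y) = e a x + e a y.
Hypothesis e_injl : forall a, (forall x, e a x = 0) -> a = 0.
Hypothesis e_injr : forall x, (forall a, e a x = 0) -> x = 0.
Notation Q := (P * D)%type.
Variables (B : 'Hom(Q, dual Q)) (f1 : 'Hom(P, Q)) (f2 : 'Hom(D, Q)).
Hypothesis BE : forall u v, B u v = pairing_form e u v.
Hypothesis f1E : forall x, f1 x = inj1 D x.
Hypothesis f2E : forall a, f2 a = inj2 P a.

Lemma memv_limg1 u : (u \in limg f1) = (u.2 == 0).
Proof.
apply/memv_imgP/eqP => [[x _ ->]|u2]; first by rewrite f1E.
by exists u.1; rewrite ?memvf// f1E /inj1 -u2; case: u {u2}.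
Qed.

Lemma memv_limg2 u : (u \in limg f2) = (u.1 == 0).
Proof.
apply/memv_imgP/eqP => [[x _ ->]|u1]; first by rewrite f2E.
by exists u.2; rewrite ?memvf// f2E /inj2 -u1; case: u {u1}.
Qed.

Variables (m k : 'Hom(P, 'End(P))) (n l : 'Hom(D, 'End(D))).
Variables (L R Lk Rk : 'Hom(P, 'End(D))) (L' R' Lk' Rk' : 'Hom(D, 'End(P))).
Hypothesis cm : coadjoint e (op m) (op n) (op L) (op R) (op L') (op R').
Hypothesis ck : coadjoint e (op k) (op l) (op Lk) (op Rk) (op Lk') (op Rk').

(** Invariance recovers both operations from their restrictions to the summands, so they must be the
    bicrossed ones. Conversely, these are invariant by construction, and the Poisson axioms are all
    that remains. *)
Lemma manin_triple_coadjointP :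
  (exists M N : 'Hom(Q, 'End(Q)),
    [/\ manin_triple M N B (limg f1) (limg f2),
        forall x y, M (f1 x) (f1 y) = f1 (m x y),
        forall x y, N (f1 x) (f1 y) = f1 (k x y),
        forall a b, M (f2 a) (f2 b) = f2 (n a b)
      & forall a b, N (f2 a) (f2 b) = f2 (l a b)]) <->
  ncPoisson (bicrossed m n L R L' R') (bicrossed k l Lk Rk Lk' Rk').
Proof.
split=> [[M [N [mt M1 N1 M2 N2]]]|Q_ncp].
  have <- : M = bicrossed m n L R L' R'.
    apply: (coadjoint_sum_unique e_addl e_addr e_injl e_injr cm).
    - by move=> u v w; rewrite -!BE; exact: mt_inv_mul mt u v w.
    - by move=> x y; rewrite -!f1E.
    - by move=> a b; rewrite -!f2E.
  have <- : N = bicrossed k l Lk Rk Lk' Rk'.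
    apply: (coadjoint_sum_unique e_addl e_addr e_injl e_injr ck).
    - by move=> u v w; rewrite -!BE; exact: mt_inv_br mt u v w.
    - by move=> x y; rewrite -!f1E.
    - by move=> a b; rewrite -!f2E.
  exact: mt_alg mt.
exists (bicrossed m n L R L' R'), (bicrossed k l Lk Rk Lk' Rk').
split=> [|x y|x y|a b|a b]; last first.
- by rewrite !f2E bicrossed22.
- by rewrite !f2E bicrossed22.
- by rewrite !f1E bicrossed11.
- by rewrite !f1E bicrossed11.
split=> //.
- by move=> u v; rewrite !BE pairing_form_sym.
- move=> u uB; apply: (pairing_form_nondeg e_addl e_addr e_injl e_injr) => v.
  by rewrite -BE.
- by move=> u v w; rewrite !BE (coadjoint_sum_invariant e_addl e_addr ck).
- by move=> u v w; rewrite !BE (coadjoint_sum_invariant e_addl e_addr cm).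
- move=> u v; rewrite !memv_limg1 => /eqP u2 /eqP v2.
  by rewrite !bicrossedE /= u2 v2 !(lfun0r, lfun0l) !addr0 !eqxx.
- move=> u v; rewrite !memv_limg2 => /eqP u1 /eqP v1.
  by rewrite !bicrossedE /= u1 v1 !(lfun0r, lfun0l) !addr0 !eqxx.
- move=> u v; rewrite !memv_limg1 BE /pairing_form => /eqP -> /eqP ->.
  by rewrite !(pairing0l e_addl) addr0.
- move=> u v; rewrite !memv_limg2 BE /pairing_form => /eqP -> /eqP ->.
  by rewrite !(pairing0r e_addr) addr0.
- apply/vspaceP => u; rewrite memvf; apply/memv_addP.
  exists (f1 u.1); first exact: memv_img (memvf _).
  exists (f2 u.2); first exact: memv_img (memvf _).
  by rewrite f1E f2E; exact: part_sum.
- apply/directv_addP/eqP; rewrite -subv0; apply/subvP => u.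
  rewrite memv_cap memv_limg1 memv_limg2 memv0.
  by case: u => x a /= /andP[/eqP -> /eqP ->].
Qed.
End ManinTriple.

(** * The cycle of implications for an abstract pairing *)

Section CoadjointEquivalences.
Variables (K : fieldType) (P D : vectType K) (e : D -> P -> K).
Hypothesis e_addl : forall a b x, e (a + b) x = e a x + e b x.
Hypothesis e_addr : forall a x y, e a (x + y) = e a x + e a y.
Hypothesis e_injl : forall a, (forall x, e a x = 0) -> a = 0.
Hypothesis e_injr : forall x, (forall a, e a x = 0) -> x = 0.
Notation Q := (P * D)%type.

(** Every implication passes through the Poisson structure on the double. A matched pair reaches it
    by way of the paired conditions. *)
Lemma coadjoint_equivalences
    (B : 'Hom(Q, dual Q)) (f1 : 'Hom(P, Q)) (f2 : 'Hom(D, Q))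
    (m k : 'Hom(P, 'End(P))) (n l : 'Hom(D, 'End(D)))
    (L R rho : 'Hom(P, 'End(D))) (L' R' rho' : 'Hom(D, 'End(P))) :
    (forall u v, B u v = pairing_form e u v) ->
    (forall x, f1 x = inj1 D x) -> (forall a, f2 a = inj2 P a) ->
    coadjoint e (op m) (op n) (op L) (op R) (op L') (op R') ->
    coadjoint e (op k) (op l) (op rho) (op (- rho)) (op rho') (op (- rho')) ->
    ncPoisson m k -> coherent m k -> ncPoisson n l -> coherent n l ->
  let pairing := bialgebra_pairing e (op m) (op k) (op n) (op l)
    (op L) (op R) (op rho) (op (- rho)) in
  let matched := matched_pair m k n l L R rho L' R' rho' in
  let manin := exists M N : 'Hom(Q, 'End(Q)),
    [/\ manin_triple M N B (limg f1) (limg f2),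
        forall x y, M (f1 x) (f1 y) = f1 (m x y),
        forall x y, N (f1 x) (f1 y) = f1 (k x y),
        forall a b, M (f2 a) (f2 b) = f2 (n a b)
      & forall a b, N (f2 a) (f2 b) = f2 (l a b)] in
  [/\ pairing -> matched, matched -> manin & manin -> pairing].
Proof.
move=> BE f1E f2E cm ck mP mcoh nP ncoh.
have pair_double :=
  coadjoint_sum_ncPoisson e_addl e_addr e_injl e_injr cm ck mP mcoh nP ncoh.
have mp_pair := matched_pair_bialgebra_pairing e_addl e_addr e_injl cm ck.
have maninP :=
  manin_triple_coadjointP e_addl e_addr e_injl e_injr BE f1E f2E cm ck.
split.
- by move=> /pair_double/ncPoisson_bicrossed_matched_pair.
- by move=> /mp_pair/pair_double/maninP.
- by move=> /maninP/ncPoisson_bicrossed_matched_pair/mp_pair.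
Qed.
End CoadjointEquivalences.

(** * The evaluation pairing of a space with its dual *)

Section DualPair.
Variables (K : fieldType) (P : vectType K).
Implicit Types (m k : 'Hom(P, 'End(P))) (n l : 'Hom(dual P, 'End(dual P))).
Notation ev := (fun (a : dual P) (x : P) => a x : K).
Notation B := (natural_form P).

Lemma ev_addl (a b : dual P) x : ev (a + b) x = ev a x + ev b x.
Proof. exact: (@add_lfunE _ P K^o). Qed.

Lemma ev_addr (a : dual P) x y : ev a (x + y) = ev a x + ev a y.
Proof. exact: (@lfunDr _ P K^o). Qed.

Lemma ev_injl (a : dual P) : (forall x, ev a x = 0) -> a = 0.
Proof.
by move=> a0; apply/lfunP => x; rewrite (@zero_lfunE _ P K^o); exact: a0.
Qed.

Lemma ev_injr x : (forall a, ev a x = 0) -> x = 0.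
Proof.
by move=> x0; apply: dual_inj => a; rewrite (@lfun0r _ P K^o); exact: x0.
Qed.

(** The outer sign cancels the one in the definition of a dual map, which leaves transposes. The
    left action transposes right multiplication, hence [flip] in the left actions. *)
Lemma coadjoint_dualrep m n :
  coadjoint ev (op m) (op n) (op (- dualrep (flip m))) (op (- dualrep m))
    (op (- corep (flip n))) (op (- corep n)).
Proof.
split=> [x a y|x a y|a x b|a x b] /=; rewrite opp_lfunE.
- by rewrite opp_lfunE opp_lfunE dualrepE flipE opprK.
- by rewrite opp_lfunE opp_lfunE dualrepE opprK.
- by rewrite opp_lfunE lfunNr corepE flipE opprK.
- by rewrite opp_lfunE lfunNr corepE opprK.
Qed.

Lemma coadjoint_dualrep_alt k l :
    (forall x, k x x = 0) -> (forall a, l a a = 0) ->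
  coadjoint ev (op k) (op l) (op (dualrep k)) (op (- dualrep k))
    (op (corep l)) (op (- corep l)).
Proof.
move=> /alt_antisym kC /alt_antisym lC;
have [_ RE _ R'E] := coadjoint_dualrep k l.
split=> // [x a y|a x b] /=.
  by rewrite dualrepE kC lfunNr opprK.
by rewrite corepE (lC b) opp_lfunE.
Qed.

Lemma natural_form_pairing u v : B u v = pairing_form ev u v.
Proof. exact: natural_formE. Qed.

End DualPair.

Theorem theorem3p9 (K : closedFieldType) (charK0 : [pchar K] =i pred0)
    (P : vectType K) (mul br : 'Hom(P, 'End(P)))
    (P_ncp : ncPoisson mul br) (P_coh : coherent mul br)
    (Delta delta : 'Hom(P, tensor P P))
    (delta_wedge : forall x, delta x \in wedge2 P)
    (Pdual_ncp : ncPoisson (dualprod Delta) (dualprod delta))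
    (Pdual_coh : coherent (dualprod Delta) (dualprod delta)) :
  [<-> (* (i) *)
       ncp_bialgebra mul br Delta delta;
       (* (ii) *)
       matched_pair mul br (dualprod Delta) (dualprod delta)
         (- dualrep (flip mul)) (- dualrep mul) (dualrep br)
         (- corep (flip (dualprod Delta))) (- corep (dualprod Delta))
         (corep (dualprod delta));
       (* (iii) *)
       standard_manin_triple mul br (dualprod Delta) (dualprod delta)].
Proof.
have cm := coadjoint_dualrep mul (dualprod Delta).
have ck := coadjoint_dualrep_alt (ncp_alt P_ncp) (ncp_alt Pdual_ncp).
have pairP := bialgebra_pairingP (coadj_L cm) (coadj_R cm) (coadj_L ck)
  (coadj_R ck) P_ncp P_coh delta_wedge Pdual_ncp Pdual_coh.
have [pair_mp mp_manin manin_pair] := coadjoint_equivalences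
  (@ev_addl _ P) (@ev_addr _ P) (@ev_injl _ P) (@ev_injr _ P)
  (@natural_form_pairing _ P) (@inPE _ P) (@inPdualE _ P)
  cm ck P_ncp P_coh Pdual_ncp Pdual_coh.
(* The kernel converts the two vector space structures carried by
   'Hom(P, K^o) much faster than the unifier does. *)
tfae.
- move=> /pairP H; exact_no_check (pair_mp H).
- exact_no_check mp_manin.
- move=> H; apply/pairP; exact_no_check (manin_pair H).
Qed.
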